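(* Let $\tilde r,\tilde s\in\mathbb{Z}$, and let $\phi_n^{(\sigma)}(x|q)$ and $\tilde L_n^{(\tilde r,\tilde s)}(\alpha,u,v,z,a)$ be the polynomials defined in the context. For $|ut|<1$, we have $$\sum_{n=0}^\infty\phi_n^{(\sigma)}(x|q)\,\tilde L_n^{(\tilde r,\tilde s)}(\alpha,u,v,z,a)\frac{t^n}{(q;q)_n}=\frac{(vt;q)_\infty}{(ut;q)_\infty}\sum_{m=0}^\infty\sum_{k=0}^\infty\sum_{j=0}^m\frac{(\sigma;q)_m\,x^m}{(q;q)_m}\,\frac{(q^{-m},ut;q)_j\,q^j}{(vt,q;q)_j}\,\frac{(-q^{-\alpha};q)_k(a;q)_k\,(tzq^j)^k}{(q^2;q^2)_k}\,q^{k\alpha+\tilde r\binom k2-\tilde s\binom{k+1}2}.$$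
   Context: Throughout, $q$ is a fixed nonzero real or complex number with $|q|<1$, and $\alpha\in\mathbb{C}$. Notation: $(a;q)_0=1$, $(a;q)_n=\prod_{k=0}^{n-1}(1-aq^k)$, $(a;q)_\infty=\prod_{k=0}^\infty(1-aq^k)$, $(a_1,\ldots,a_r;q)_n=(a_1;q)_n\cdots(a_r;q)_n$; similarly with base $q^2$. $q$-binomial coefficients: for $\alpha\in\mathbb{C}$ and integers $k\ge 0$, $$\begin{bmatrix}\alpha\\k\end{bmatrix}_q=\frac{(q^{-\alpha};q)_k}{(q;q)_k}(-1)^kq^{\alpha k-\binom k2},\qquad \begin{bmatrix}\alpha\\k\end{bmatrix}_{-q}=\frac{(-q^{-\alpha};q)_k}{(-q;q)_k}q^{\alpha k-\binom k2}.$$ Cauchy polynomials: $p_n(u,v)=(u-v)(u-qv)\cdots(u-q^{n-1}v)=(v/u;q)_n\,u^n$, $p_0=1$. Generalized $q$-polynomials: $$\tilde L_n^{(\tilde r,\tilde s)}(\alpha,u,v,z,a)=\sum_{k=0}^n\begin{bmatrix}n\\k\end{bmatrix}_q\begin{bmatrix}\alpha\\k\end{bmatrix}_{-q}q^{\tilde r\binom k2-\tilde s\binom{k+1}2+\binom k2}(a;q)_k\,p_{n-k}(u,v)\,z^k.$$ Hahn (or Al-Salam and Carlitz) polynomials: $\phi_n^{(\sigma)}(x|q)=\sum_{k=0}^n\begin{bmatrix}n\\k\end{bmatrix}_q(\sigma;q)_k\,x^k$.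
   Formalization: The identity is stated when the right-hand series converges (the sum over k for each m, then the sum over m) and vt·q^i ≠ 1 for all i ≥ 0; |ut|<1 alone does not ensure this (z=v=σ=0, |x|>1, |xut|≥1 diverges); convergence of the left side is proved. *)

(* Defs.v *)
From HB Require Import structures.
From mathcomp Require Import all_boot all_order all_algebra.
From mathcomp Require Import all_classical all_reals all_analysis.
From mathcomp Require Import complex.
Set Implicit Arguments.
Unset Strict Implicit.
Unset Printing Implicit Defensive.
Import Order.TTheory GRing.Theory Num.Theory.
Import numFieldNormedType.Exports.
Local Open Scope classical_set_scope.
Local Open Scope ring_scope.

(* The ascription to numClosedFieldType is what gives R[i] the topology of its
   modulus, through the coercions of numFieldNormedType. *)
Definition cplx (R : realType) : numClosedFieldType := R[i].

Definition cexp (R : realType) (w : cplx R) : cplx R :=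
  let: Complex a b := w in Complex (expR a * cos b) (expR a * sin b).

Section QSeries.
Variable R : realType.
Local Notation C := (cplx R).

(* Total: equals 0 when the series diverges, so convergence has to be asserted
   separately. *)
Definition infsum (f : nat -> C) : C := limn (series f).

Definition infsum_cvg (f : nat -> C) : Prop := cvgn (series f).

(* The power q^w for the determination lq of log q, that is, cexp lq = q. *)
Definition qpow (lq w : C) : C := cexp (w * lq).

Definition qpoch (a q : C) (n : nat) : C := \prod_(k < n) (1 - a * q ^+ k).

Definition qpoch_inf (a q : C) : C := limn (qpoch a q).

Definition qbin (q lq al : C) (k : nat) : C :=
  qpoch (qpow lq (- al)) q k / qpoch q q k * (-1) ^+ k
  * qpow lq (al * k%:R - 'C(k, 2)%:R).

(* The coefficient of base -q. Its powers are powers of q, so that no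
   determination of log (-q) is involved. *)
Definition qbin_neg (q lq al : C) (k : nat) : C :=
  qpoch (- qpow lq (- al)) q k / qpoch (- q) q k
  * qpow lq (al * k%:R - 'C(k, 2)%:R).

Definition cauchy_poly (q : C) (n : nat) (u v : C) : C :=
  \prod_(k < n) (u - q ^+ k * v).

Definition Ltilde (q lq : C) (r s : int) (n : nat) (al u v z a : C) : C :=
  \sum_(k < n.+1)
    qbin q lq n%:R k * qbin_neg q lq al k
    * q ^ (r * 'C(k, 2)%:Z - s * 'C(k.+1, 2)%:Z + 'C(k, 2)%:Z)
    * qpoch a q k * cauchy_poly q (n - k) u v * z ^+ k.

Definition hahn_poly (q lq sigma : C) (n : nat) (x : C) : C :=
  \sum_(k < n.+1) qbin q lq n%:R k * qpoch sigma q k * x ^+ k.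

End QSeries.

(* Main.v *)
Require Import Defs.
From HB Require Import structures.
From mathcomp Require Import all_boot all_order all_algebra.
From mathcomp Require Import all_classical all_reals all_analysis.
From mathcomp Require Import complex.
From mathcomp Require Import ring lra zify.
Set Implicit Arguments.
Unset Strict Implicit.
Unset Printing Implicit Defensive.
Import Order.TTheory GRing.Theory Num.Theory.
Import numFieldNormedType.Exports.
Local Open Scope classical_set_scope.
Local Open Scope ring_scope.

(* Put d_m = (sigma;q)_m x^m / (q;q)_m, U = ut, V = vt, and let B_n be the
   coefficients of the product of F(y) = sum_n p_n(U,V) y^n / (q;q)_n and
   H(y) = sum_k g_k y^k, where g_k is the k-dependent factor of the right-hand
   side at j = 0.  With A_n = (q;q)_n B_n, the n-th term on the left is
   A_n sum_(m <= n) d_m / (q;q)_(n-m).  On the right, the q-binomial theorem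
   turns (V;q)_oo / (U;q)_oo * (U;q)_j / (V;q)_j into F(q^j), and the sum over j
   of the coefficients (q^-m;q)_j q^j / (q;q)_j against F(q^j) H(q^j) is
   S_m = sum_i A_(m+i) / (q;q)_i; so the m-th term is d_m S_m, and the identity
   is an exchange of the sums over m and n.

   The exchange is not absolutely convergent a priori when |x| >= 1.  However:
   - the hypothesis at m = 0 gives g_k -> 0, which by the shape of the ratio
     g_(k+1) / g_k forces g, hence A, to decay geometrically;
   - if d is unbounded, then |d_m| grows exactly like |x|^m with |x| > 1, and
     d_m S_m -> 0 gives S_m = o(|x|^-m).  Inverting A -> S by the operator
     product (T;q)_oo, with T the shift, yields A_n = o(|x|^-n).
   In both cases the two partial sums up to N differ by a quantity that tends
   to 0. *)

(** * The modulus with values in [R] *)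

Section Modulus.
Variable R : realType.
Local Notation C := (cplx R).

(* `|x| is an element of C, where the order is only partial; this is the same
   number in R. *)
Definition modulus (x : C) : R := complex.Re `|x|.

Lemma modulusE (x : C) : `|x| = (modulus x)%:C%C.
Proof. by rewrite /modulus normc_def. Qed.

Lemma modulus_lt (x y : C) : (`|x| < `|y|) = (modulus x < modulus y).
Proof. by rewrite !modulusE ltcR. Qed.

Lemma modulusM (x y : C) : modulus (x * y) = modulus x * modulus y.
Proof. by apply: (@complexI R); rewrite rmorphM /= -!modulusE normrM. Qed.

Lemma modulus1 : modulus 1 = 1.
Proof. by apply: (@complexI R); rewrite -modulusE normr1. Qed.

Lemma modulus0 : modulus 0 = 0.
Proof. by apply: (@complexI R); rewrite -modulusE normr0. Qed.

Lemma modulusV (x : C) : modulus x^-1 = (modulus x)^-1.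
Proof. by apply: (@complexI R); rewrite -modulusE normfV modulusE fmorphV. Qed.

Lemma modulusX (x : C) n : modulus (x ^+ n) = modulus x ^+ n.
Proof. by apply: (@complexI R); rewrite -modulusE normrX modulusE rmorphXn. Qed.

Lemma modulusN (x : C) : modulus (- x) = modulus x.
Proof. by apply: (@complexI R); rewrite -!modulusE normrN. Qed.

Lemma modulusD (x y : C) : modulus (x + y) <= modulus x + modulus y.
Proof. by rewrite -lecR rmorphD /= -!modulusE ler_normD. Qed.

Lemma modulus_ge0 (x : C) : 0 <= modulus x.
Proof. by rewrite -lecR -modulusE normr_ge0. Qed.

Lemma modulus_gt0 (x : C) : (0 < modulus x) = (x != 0).
Proof. by rewrite -ltcR -modulusE normr_gt0. Qed.

Lemma modulus_lt1 (x : C) : (`|x| < 1) = (modulus x < 1).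
Proof. by rewrite -[1 in LHS]normr1 modulus_lt modulus1. Qed.

Lemma modulus_sum I (r : seq I) (P : pred I) (F : I -> C) :
  modulus (\sum_(i <- r | P i) F i) <= \sum_(i <- r | P i) modulus (F i).
Proof.
apply: (big_ind2 (fun x y => modulus x <= y)) => //; first by rewrite modulus0.
by move=> x1 x2 y1 y2 h1 h2; apply: (le_trans (modulusD _ _)); apply: lerD.
Qed.

Lemma modulus_prod I (r : seq I) (P : pred I) (F : I -> C) :
  modulus (\prod_(i <- r | P i) F i) = \prod_(i <- r | P i) modulus (F i).
Proof. by apply: big_morph; [exact: modulusM|exact: modulus1]. Qed.

Lemma modulus_real (a : R) : modulus a%:C%C = `|a|.
Proof. by rewrite /modulus normc_def /= expr0n /= addr0 sqrtr_sqr. Qed.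

Lemma modulus_i : modulus 'i%C = 1.
Proof. by rewrite /modulus normc_def /= expr0n /= add0r expr1n sqrtr1. Qed.

Lemma Re_le_modulus (x : C) : `|complex.Re x| <= modulus x.
Proof. by rewrite -lecR -modulusE; apply: normc_ge_Re. Qed.

Lemma Im_le_modulus (x : C) : `|complex.Im x| <= modulus x.
Proof.
case: x => a b; rewrite /modulus normc_def /= -(sqrtr_sqr b).
by rewrite ler_sqrt ?addr_ge0 ?sqr_ge0 // lerDr sqr_ge0.
Qed.

Lemma cvg_modulus_lt (f : nat -> C) (l : C) :
  f @ \oo --> l <->
  (forall e : R, 0 < e -> \forall n \near \oo, modulus (f n - l) < e).
Proof.
split=> [/cvgrPdist_lt h e e0|h].
  have /h : 0 < e%:C%C :> C by rewrite ltcR.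
  by apply: filterS => n; rewrite distrC modulusE ltcR.
apply/cvgrPdist_lt => e e0.
have eE : e = (complex.Re e)%:C%C by rewrite RRe_real // ger0_real // ltW.
have e1 : 0 < complex.Re e by rewrite -ltcR -eE.
by near=> n; rewrite eE distrC modulusE ltcR; near: n; apply: h.
Unshelve. all: by end_near. Qed.

Lemma cvg_modulus (f : nat -> C) (l : C) :
  f @ \oo --> l <-> (fun n => modulus (f n - l)) @ \oo --> (0 : R).
Proof.
rewrite cvg_modulus_lt; split=> h.
  apply/cvgrPdist_lt => e e0; near=> n.
  by rewrite sub0r normrN ger0_norm ?modulus_ge0 //; near: n; apply: h.
move=> e e0; move/cvgrPdist_lt: h => /(_ e e0); apply: filterS => n.
by rewrite sub0r normrN ger0_norm // modulus_ge0.
Unshelve. all: by end_near. Qed.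

Lemma cvg0_modulus (f : nat -> C) :
  f @ \oo --> (0 : C) <-> (fun n => modulus (f n)) @ \oo --> (0 : R).
Proof.
rewrite cvg_modulus.
by under [X in (X @ _ --> _) <-> _]eq_fun do rewrite subr0.
Qed.

Lemma cvg0_modulus_le (f : nat -> C) (b : nat -> R) :
  (forall n, modulus (f n) <= b n) -> b @ \oo --> (0 : R) ->
  f @ \oo --> (0 : C).
Proof.
move=> fb b0; apply/cvg0_modulus; apply: (squeeze_cvgr _ (cvg_cst 0) b0).
by near=> n; rewrite modulus_ge0 fb.
Unshelve. all: by end_near. Qed.

Lemma cvg_modulus_lim (f : nat -> C) (l : C) :
  f @ \oo --> l -> (fun n => modulus (f n)) @ \oo --> modulus l.
Proof.
move=> /cvg_modulus_lt h; apply/cvgrPdist_lt => e e0.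
near=> n; have h1 : modulus (f n - l) < e by near: n; apply: h.
rewrite distrC ltr_norml; apply/andP; split.
  have := modulusD (f n) (- (f n - l)); rewrite modulusN opprB addrC subrK.
  by lra.
by have := modulusD (f n - l) l; rewrite subrK; lra.
Unshelve. all: by end_near. Qed.

Lemma cvg_modulus_bounded (f : nat -> C) : cvgn f ->
  exists K : R, forall n, modulus (f n) <= K.
Proof.
move=> /cvg_modulus_lim cf.
have := cvg_seq_bounded (cvgP _ cf).
move=> /pinfty_ex_gt0 [K _ hK]; exists K => n.
by rewrite (le_trans (ler_norm _)) // hK.
Qed.

Lemma cvg_ReIm (f : nat -> C) (a b : R) :
  (fun n => complex.Re (f n)) @ \oo --> a ->
  (fun n => complex.Im (f n)) @ \oo --> b ->
  f @ \oo --> ((a +i* b)%C : C).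
Proof.
move=> /cvgrPdist_lt ha /cvgrPdist_lt hb; apply/cvg_modulus_lt => e e0.
have e2 : 0 < e / 2 by rewrite divr_gt0.
near=> n.
have := modulusD (complex.Re (f n) - a)%:C%C ('i%C * (complex.Im (f n) - b)%:C%C).
have -> : (complex.Re (f n) - a)%:C%C + 'i%C * (complex.Im (f n) - b)%:C%C
  = f n - (a +i* b)%C by case: (f n) => x y; simpc.
move=> /le_lt_trans; apply.
rewrite modulusM modulus_i mul1r !modulus_real (splitr e).
by rewrite ltrD // distrC; near: n; [apply: ha|apply: hb].
Unshelve. all: by end_near. Qed.

Lemma Re_series (f : nat -> C) n :
  complex.Re (series f n) = series (fun k => complex.Re (f k)) n.
Proof. by rewrite /series /= (big_morph _ (@raddfD _ _ (@complex.Re R)) (raddf0 _)). Qed.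

Lemma Im_series (f : nat -> C) n :
  complex.Im (series f n) = series (fun k => complex.Im (f k)) n.
Proof. by rewrite /series /= (big_morph _ (@raddfD _ _ (@complex.Im R)) (raddf0 _)). Qed.

Lemma cvg_series_modulus (f : nat -> C) (b : nat -> R) :
  (forall n, modulus (f n) <= b n) -> cvgn (series b) -> cvgn (series f).
Proof.
move=> fb cb.
have b0 n : 0 <= b n by rewrite (le_trans (modulus_ge0 _) (fb n)).
have H (g : nat -> R) : (forall n, `|g n| <= b n) -> cvgn (series g).
  move=> gb; apply: normed_cvg => /=.
  by apply: (@series_le_cvg _ _ b) => //= n.
have /H/cvg_ex[u hu] : forall n, `|complex.Re (f n)| <= b n.
  by move=> n; apply: le_trans (fb n); apply: Re_le_modulus.
have /H/cvg_ex[v hv] : forall n, `|complex.Im (f n)| <= b n.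
  by move=> n; apply: le_trans (fb n); apply: Im_le_modulus.
apply/cvg_ex; exists (u +i* v)%C; apply: cvg_ReIm.
  by under eq_fun do rewrite Re_series.
by under eq_fun do rewrite Im_series.
Qed.

End Modulus.

(** * Geometrically bounded sequences *)

Section GeometricBounds.
Variable R : realType.
Local Notation C := (cplx R).
Implicit Types f g h : nat -> C.

Lemma sum_expr_le (rho : R) n : 0 <= rho < 1 ->
  \sum_(i < n) rho ^+ i <= (1 - rho)^-1.
Proof.
move=> /andP[r0 r1]; rewrite -[leRHS]mul1r ler_pdivlMr ?subr_gt0 //.
rewrite mulrC -opprB mulNr -subrX1 opprB.
by rewrite lerBlDr lerDl exprn_ge0.
Qed.

Lemma natr_expr_le (rho : R) n : 0 <= rho < 1 ->
  n%:R * rho ^+ n <= (1 - rho)^-1.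
Proof.
move=> r01; apply: le_trans (sum_expr_le n r01).
rewrite mulr_natl -[X in _ *+ X]card_ord -sumr_const.
case/andP: r01 => r0 r1; apply: ler_sum => i _.
by apply: ler_wiXn2l => //; [exact: ltW|exact: ltnW].
Qed.

Definition geom_bounded f := exists c rho : R,
  [/\ 0 <= c, 0 < rho, rho < 1 & forall n, modulus (f n) <= c * rho ^+ n].

Lemma geom_bounded_le f h : (forall n, modulus (h n) <= modulus (f n)) ->
  geom_bounded f -> geom_bounded h.
Proof.
move=> hf [c [rho [c0 r0 r1 fb]]]; exists c, rho; split => // n.
exact: le_trans (hf n) (fb n).
Qed.

Lemma geom_bounded_common f g : geom_bounded f -> geom_bounded g ->
  exists c rho : R, [/\ 0 <= c, 0 < rho, rho < 1,
    forall n, modulus (f n) <= c * rho ^+ n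
    & forall n, modulus (g n) <= c * rho ^+ n].
Proof.
move=> [c [r [c0 r0 r1 fb]]] [d [s [d0 s0 s1 gb]]].
exists (c + d), (Num.max r s); split.
- exact: addr_ge0.
- by rewrite lt_max r0.
- by rewrite gt_max r1 s1.
- move=> n; apply: le_trans (fb n) _; apply: ler_pM => //.
  + by rewrite exprn_ge0 // ltW.
  + by rewrite lerDl.
  + by rewrite lerXn2r ?nnegrE ?le_max ?lexx ?(ltW r0).
- move=> n; apply: le_trans (gb n) _; apply: ler_pM => //.
  + by rewrite exprn_ge0 // ltW.
  + by rewrite lerDr.
  + by rewrite lerXn2r ?nnegrE ?le_max ?lexx ?(ltW s0) ?orbT.
Qed.

Lemma cvg_scaled_expr0 (c rho : R) : 0 < rho -> rho < 1 ->
  (fun n => c * rho ^+ n) @ \oo --> (0 : R).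
Proof. by move=> r0 r1; apply: cvg_geometric; rewrite ger0_norm // ltW. Qed.

Lemma geom_bounded_cvg0 f : geom_bounded f -> f @ \oo --> (0 : C).
Proof.
move=> [c [rho [c0 r0 r1 fb]]]; apply: cvg0_modulus_le fb _.
exact: cvg_scaled_expr0.
Qed.

Lemma geom_bounded_cvg f : geom_bounded f -> cvgn (series f).
Proof.
move=> [c [rho [c0 r0 r1 fb]]]; apply: cvg_series_modulus fb _.
by apply: is_cvg_geometric_series; rewrite ger0_norm // ltW.
Qed.

Lemma geom_boundedM f h (K : R) : (forall n, modulus (h n) <= K) ->
  geom_bounded f -> geom_bounded (fun n => h n * f n).
Proof.
move=> hK [c [rho [c0 r0 r1 fb]]].
have K0 : 0 <= K by apply: le_trans (hK 0%N); exact: modulus_ge0.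
exists (K * c), rho; split => // [|n]; first exact: mulr_ge0.
by rewrite modulusM -mulrA ler_pM ?modulus_ge0.
Qed.

Lemma geom_bounded_eventually f N (c rho : R) : 0 < rho -> rho < 1 ->
  (forall n, (N <= n)%N -> modulus (f n) <= c * rho ^+ n) -> geom_bounded f.
Proof.
move=> r0 r1 fb.
pose d := `|c| + \sum_(i < N) modulus (f i) / rho ^+ i.
exists d, rho; split => // [|n].
  rewrite addr_ge0 // sumr_ge0 // => i _.
  by rewrite divr_ge0 ?modulus_ge0 // exprn_ge0 // ltW.
have [nN|Nn] := ltnP n N.
  rewrite -ler_pdivrMr ?exprn_gt0 // /d (bigD1 (Ordinal nN)) //=.
  rewrite addrCA lerDl addr_ge0 // sumr_ge0 // => i _.
  by rewrite divr_ge0 ?modulus_ge0 // exprn_ge0 // ltW.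
apply: le_trans (fb n Nn) _; rewrite ler_pM2r ?exprn_gt0 //.
rewrite (le_trans (ler_norm c)) // lerDl sumr_ge0 // => i _.
by rewrite divr_ge0 ?modulus_ge0 // exprn_ge0 // ltW.
Qed.

Lemma geom_bounded_ratio f (tau : nat -> C) (l : C) :
  (forall n, f n.+1 = f n * tau n) -> tau @ \oo --> l -> modulus l < 1 ->
  geom_bounded f.
Proof.
move=> fS /cvg_modulus_lim tl l1.
pose rho := (modulus l + 1) / 2.
have l0 := modulus_ge0 l.
have r0 : 0 < rho by rewrite /rho; lra.
have r1 : rho < 1 by rewrite /rho; lra.
have [N _ hN] : \forall n \near \oo, modulus (tau n) < rho.
  by apply: (cvgr_lt _ tl); rewrite /rho; lra.
apply: (@geom_bounded_eventually _ N (modulus (f N) / rho ^+ N) rho) => // n.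
move=> /subnK <-; elim: (n - N)%N => [|k IH].
  by rewrite add0n divfK // gt_eqF // exprn_gt0.
rewrite addSn fS modulusM exprSr mulrA ler_pM ?modulus_ge0 //.
by apply/ltW/hN; rewrite /= leq_addl.
Qed.

Lemma geom_bounded_natr f : geom_bounded f -> geom_bounded (fun n => n%:R * f n).
Proof.
move=> [c [rho [c0 r0 r1 fb]]]; pose s := Num.sqrt rho.
have s0 : 0 < s by rewrite sqrtr_gt0.
have s1 : s < 1 by rewrite -sqrtr1 ltr_sqrt.
have sE : rho = s * s by rewrite -expr2 sqr_sqrtr // ltW.
exists (c / (1 - s)), s; split => // [|n].
  by rewrite divr_ge0 // subr_ge0 ltW.
rewrite modulusM.
have -> : modulus (n%:R : C) = n%:R :> R.
  by rewrite /modulus normr_nat -(rmorph_nat (@real_complex R)).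
have := @natr_expr_le s n; rewrite s1 (ltW s0) => /(_ isT) h.
apply: (@le_trans _ _ (n%:R * (c * rho ^+ n))); first exact: ler_wpM2l.
rewrite sE exprMn mulrCA -[leRHS]mulrA ler_wpM2l // mulrA ler_wpM2r //.
by rewrite exprn_ge0 // ltW.
Qed.

Lemma geom_bounded_shift f m : geom_bounded f -> geom_bounded (fun n => f (m + n)%N).
Proof.
move=> [c [rho [c0 r0 r1 fb]]]; exists (c * rho ^+ m), rho; split => // [|n].
  by rewrite mulr_ge0 // exprn_ge0 // ltW.
by rewrite -mulrA -exprD.
Qed.

Lemma modulus_tail_le f (c rho : R) p : 0 <= c -> 0 <= rho < 1 ->
  (forall i, (p <= i)%N -> modulus (f i) <= c * rho ^+ i) ->
  cvgn (series f) ->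
  modulus (limn (series f) - series f p) <= c * rho ^+ p / (1 - rho).
Proof.
move=> c0 r01 fb cf.
have h : (fun n => modulus (series f n - series f p)) @ \oo -->
    modulus (limn (series f) - series f p).
  apply: (@cvg_modulus_lim _ (fun n => series f n - series f p)).
  exact: cvgB cf (cvg_cst _).
apply: (cvgr_to_le h).
near=> n; have pn : (p <= n)%N by near: n; exists p.
rewrite sub_series_geq //; apply: (le_trans (modulus_sum _ _ _)).
apply: (@le_trans _ _ (\sum_(p <= k < n) c * rho ^+ k)).
  by rewrite big_nat_cond [leRHS]big_nat_cond; apply: ler_sum => i /andP[/andP[/fb]].
rewrite -{1}(add0n p) big_addn big_mkord.
under eq_bigr do rewrite exprD mulrCA.
rewrite -mulr_suml mulrC ler_wpM2l ?sum_expr_le //.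
by case/andP: r01 => r0 _; rewrite mulr_ge0 // exprn_ge0.
Unshelve. all: by end_near. Qed.

Definition convolution f g n := \sum_(i < n.+1) f i * g (n - i)%N.

Lemma sum_triangle (F : nat -> nat -> C) N :
  \sum_(n < N) \sum_(i < n.+1) F i (n - i)%N = \sum_(i < N) \sum_(j < N - i) F i j.
Proof.
elim: N => [|N IH]; first by rewrite !big_ord0.
rewrite big_ord_recr IH [RHS]big_ord_recr /= subSnn big_ord1.
rewrite [X in _ + X]big_ord_recr /= subnn addrA; congr (_ + _).
rewrite -big_split; apply: eq_bigr => i _ /=.
by rewrite subSn ?big_ord_recr // ltnW.
Qed.

Lemma geom_bounded_convolution f g :
  geom_bounded f -> geom_bounded g -> geom_bounded (convolution f g).
Proof.
move=> bf bg; have [c [rho [c0 r0 r1 fb gb]]] := geom_bounded_common bf bg.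
have /geom_bounded_natr : geom_bounded (fun n => ((c * c / rho) * rho ^+ n)%:C%C).
  exists (c * c / rho), rho; split => //.
    by rewrite divr_ge0 ?mulr_ge0 // ltW.
  move=> n; rewrite modulus_real ger0_norm //.
  by rewrite mulr_ge0 ?divr_ge0 ?mulr_ge0 ?exprn_ge0 // ltW.
move=> /(geom_bounded_shift 1); apply: geom_bounded_le => n.
have -> : (1 + n)%:R * ((c * c / rho) * rho ^+ (1 + n))%:C%C
    = ((c * c * rho ^+ n) *+ n.+1)%:C%C :> C.
  rewrite add1n exprS -(rmorph_nat (@real_complex R)) -rmorphM; congr (_%:C)%C.
  by rewrite -mulr_natl; field; rewrite gt_eqF.
rewrite modulus_real ger0_norm; last first.
  by rewrite mulrn_wge0 // mulr_ge0 ?mulr_ge0 ?exprn_ge0 // ltW.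
apply: le_trans (modulus_sum _ _ _) _.
rewrite -[X in _ *+ X]card_ord -sumr_const; apply: ler_sum => i _.
rewrite modulusM -[in leRHS](subnKC (ltnSE (ltn_ord i))) exprD mulrACA.
by rewrite ler_pM ?modulus_ge0.
Qed.

Lemma cvg_series_convolution f g : geom_bounded f -> geom_bounded g ->
  series (convolution f g) @ \oo --> limn (series f) * limn (series g).
Proof.
move=> bf bg; have [c [rho [c0 r0 r1 fb gb]]] := geom_bounded_common bf bg.
have cf := geom_bounded_cvg bf; have cg := geom_bounded_cvg bg.
pose G := limn (series g).
pose E N := \sum_(i < N) f i * (G - series g (N - i)%N).
have -> : series (convolution f g) = (fun N => series f N * G - E N).
  apply/funext => N; rewrite /series /= !big_mkord mulr_suml -sumrB.
  under eq_bigr do rewrite /convolution.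
  rewrite (sum_triangle (fun i j => f i * g j)).
  apply: eq_bigr => i _; rewrite -mulrBr opprB addrC subrK mulr_sumr /series /=.
  by rewrite big_mkord.
rewrite -[X in _ --> X]subr0; apply: cvgB.
  exact: cvgM cf (cvg_cst _).
pose b N := (N%:R : C) * (c * c / (1 - rho) * rho ^+ N)%:C%C.
have nn N : 0 <= c * c / (1 - rho) * rho ^+ N.
  by rewrite mulr_ge0 ?exprn_ge0 ?divr_ge0 ?mulr_ge0 ?subr_ge0 // ltW.
have /geom_bounded_cvg0/cvg0_modulus b0 : geom_bounded b.
  apply: geom_bounded_natr; exists (c * c / (1 - rho)), rho; split => //.
    by have := nn 0%N; rewrite mulr1.
  by move=> n; rewrite modulus_real ger0_norm.
apply: cvg0_modulus_le b0 => N.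
have -> : b N = ((c * c / (1 - rho) * rho ^+ N) *+ N)%:C%C.
  rewrite /b -(rmorph_nat (@real_complex R)) -rmorphM; congr (_%:C)%C.
  by rewrite mulr_natl.
rewrite modulus_real ger0_norm; last by rewrite mulrn_wge0.
apply: le_trans (modulus_sum _ _ _) _.
rewrite -[X in _ *+ X]card_ord -sumr_const; apply: ler_sum => i _.
rewrite modulusM -[in leRHS](subnKC (ltnW (ltn_ord i))) exprD.
have -> : c * c / (1 - rho) * (rho ^+ i * rho ^+ (N - i)) =
  (c * rho ^+ i) * (c * rho ^+ (N - i) / (1 - rho)) by ring.
rewrite ler_pM ?modulus_ge0 //.
by apply: modulus_tail_le => //; rewrite (ltW r0).
Qed.

End GeometricBounds.

(** * q-shifted factorials *)

Section QPochhammer.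
Variable R : realType.
Local Notation C := (cplx R).

Lemma modulus_prod1D_bounded (f : nat -> C) : geom_bounded f ->
  exists K : R, forall n, modulus (\prod_(i < n) (1 + f i)) <= K.
Proof.
move=> [c [rho [c0 r0 r1 fb]]]; exists (expR (c / (1 - rho))) => n.
apply: (@le_trans _ _ (expR (\sum_(i < n) c * rho ^+ i))); last first.
  rewrite ler_expR -mulr_sumr ler_wpM2l // sum_expr_le //.
  by rewrite (ltW r0).
elim: n => [|n IH]; first by rewrite !big_ord0 modulus1 expR0.
rewrite !big_ord_recr /= modulusM expRD ler_pM ?modulus_ge0 //.
apply: (le_trans (modulusD _ _)); rewrite modulus1.
by apply: le_trans (expR_ge1Dx _); rewrite lerD2l.
Qed.

Variable q : C.
Hypothesis q_lt1 : `|q| < 1.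

Lemma geom_bounded_expr (a : C) : `|a| < 1 -> geom_bounded (fun n => a ^+ n).
Proof.
rewrite modulus_lt1 => a1.
apply: (@geom_bounded_ratio _ _ (fun=> a) a) => // [n|]; first exact: exprSr.
exact: cvg_cst.
Qed.

Lemma qpochS (a : C) n : qpoch a q n.+1 = qpoch a q n * (1 - a * q ^+ n).
Proof. by rewrite /qpoch big_ord_recr. Qed.

Lemma qpochD (a : C) m n : qpoch a q (m + n) = qpoch a q m * qpoch (a * q ^+ m) q n.
Proof.
rewrite /qpoch big_split_ord; congr (_ * _); apply: eq_bigr => i _ /=.
by rewrite exprD mulrA.
Qed.

Lemma qpoch_neq0 (a : C) n : (forall k, a * q ^+ k != 1) -> qpoch a q n != 0.
Proof.
by move=> h; apply/prodf_neq0 => i _; rewrite subr_eq0 eq_sym.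
Qed.

Lemma small_expr_neq1 (a : C) k : `|a| < 1 -> a * q ^+ k != 1.
Proof.
move=> a1; apply/eqP => e; have : `|a * q ^+ k| < 1.
  by rewrite normrM normrX (le_lt_trans _ a1) // ler_piMr ?exprn_ile1 // ltW.
by rewrite e normr1 ltxx.
Qed.

Lemma qpoch_bounded (a : C) : exists K : R, forall n, modulus (qpoch a q n) <= K.
Proof.
have [] := @modulus_prod1D_bounded (fun n => - a * q ^+ n).
  apply: (@geom_boundedM _ _ (fun=> - a) (modulus (- a))) => //.
  exact: geom_bounded_expr.
by move=> K h; exists K => n; under [qpoch _ _ _]eq_bigr do rewrite -mulNr.
Qed.

Lemma cvg_1Bexpr (a : C) : (fun n => 1 - a * q ^+ n) @ \oo --> (1 : C).
Proof.
have q0 := geom_bounded_cvg0 (geom_bounded_expr q_lt1).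
have h := cvgB (cvg_cst (1 : C)) (cvgM (cvg_cst a) q0).
rewrite mulr0 subr0 in h; exact: h.
Qed.

Lemma qpochV_bounded (a : C) : (forall k, a * q ^+ k != 1) ->
  exists K : R, forall n, modulus (qpoch a q n)^-1 <= K.
Proof.
move=> a1.
have nz n : 1 - a * q ^+ n != 0 by rewrite subr_eq0 eq_sym.
have [M hM] : exists M : R, forall n, modulus (1 - a * q ^+ n)^-1 <= M.
  apply: cvg_modulus_bounded; apply: (cvgP (1^-1 : C)).
  by apply: cvgV (oner_neq0 _) (cvg_1Bexpr a).
have [] := @modulus_prod1D_bounded (fun n => (a / (1 - a * q ^+ n)) * q ^+ n).
  apply: (@geom_boundedM _ _ _ (modulus a * M)); last exact: geom_bounded_expr.
  by move=> n; rewrite modulusM ler_wpM2l // modulus_ge0.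
move=> K h; exists K => n; rewrite /qpoch -prodfV.
have -> : \prod_(i < n) (1 - a * q ^+ i)^-1 =
    \prod_(i < n) (1 + (a / (1 - a * q ^+ i)) * q ^+ i).
  by apply: eq_bigr => i _; field.
exact: h.
Qed.

Lemma qpoch_cvg (a : C) : cvgn (qpoch a q).
Proof.
have [K hK] := qpoch_bounded a.
have /geom_bounded_cvg/cvg_ex[l hl] :
    geom_bounded (fun n => (- a * qpoch a q n) * q ^+ n).
  apply: (@geom_boundedM _ _ _ (modulus a * K)); last exact: geom_bounded_expr.
  by move=> n; rewrite modulusM modulusN ler_wpM2l // modulus_ge0.
apply: (cvgP (l + 1)).
have -> : qpoch a q = (fun n => series (fun n => (- a * qpoch a q n) * q ^+ n) n + 1).
  apply/funext; elim=> [|n IH]; last rewrite seriesSr.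
    by rewrite /series /= big_geq // /qpoch big_ord0 add0r.
  have -> : series (fun n => (- a * qpoch a q n) * q ^+ n) n = qpoch a q n - 1.
    by rewrite IH addrK.
  by rewrite qpochS; ring.
exact: cvgD hl (cvg_cst _).
Qed.

Lemma qpoch_inf_neq0 (a : C) : (forall k, a * q ^+ k != 1) -> qpoch_inf a q != 0.
Proof.
move=> a1; have [K hK] := qpochV_bounded a1.
have K0 : 0 < K.
  by apply: lt_le_trans (hK 0%N); rewrite modulus_gt0 invr_neq0 // qpoch_neq0.
rewrite -modulus_gt0; apply: (@lt_le_trans _ _ K^-1); first by rewrite invr_gt0.
have h := cvg_modulus_lim (@qpoch_cvg a).
apply: (cvgr_to_ge h); near=> n.
rewrite -[leRHS]invrK -modulusV lef_pV2 ?posrE // modulus_gt0.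
by rewrite invr_neq0 // qpoch_neq0.
Unshelve. all: by end_near. Qed.

Lemma qfact_neq0 n : qpoch q q n != 0.
Proof. by apply: qpoch_neq0 => k; exact: small_expr_neq1. Qed.

Lemma qfactV_bounded : exists K : R, forall n, modulus (qpoch q q n)^-1 <= K.
Proof. by apply: qpochV_bounded => k; exact: small_expr_neq1. Qed.

End QPochhammer.

(** * Inversion of the tail sums *)

Section PowerSeriesAtPowers.
Variables (R : realType) (q : cplx R).
Local Notation C := (cplx R).
Hypothesis q_lt1 : `|q| < 1.

Lemma modulus_expr_le1 n : modulus (q ^+ n) <= 1.
Proof.
by rewrite modulusX exprn_ile1 ?modulus_ge0 // ltW // -modulus_lt1.
Qed.

Lemma geom_bounded_power (f : nat -> C) N :
  geom_bounded f -> geom_bounded (fun n => q ^+ (N * n) * f n).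
Proof.
by apply: geom_boundedM => n; apply: modulus_expr_le1.
Qed.

Lemma cvg_power_series_expr (f : nat -> C) : geom_bounded f ->
  (fun N => limn (series (fun n => q ^+ (N * n) * f n))) @ \oo --> f 0%N.
Proof.
move=> bf; have [c [rho [c0 r0 r1 fb]]] := bf.
have bnd N : modulus (limn (series (fun n => q ^+ (N * n) * f n)) - f 0%N) <=
    (c / (1 - rho)) * modulus q ^+ N.
  have := @modulus_tail_le _ (fun n => q ^+ (N * n) * f n) (modulus q ^+ N * c) rho 1.
  have -> : series (fun n => q ^+ (N * n) * f n) 1 = f 0%N.
    by rewrite /series /= big_nat1 muln0 mul1r.
  have e0 : 0 <= modulus q ^+ N by rewrite exprn_ge0 // modulus_ge0.
  move=> h; apply: (le_trans (h _ _ _ _)).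
  - exact: mulr_ge0.
  - by rewrite (ltW r0).
  - move=> i i1; rewrite -{1}(prednK i1) mulnS exprD !modulusM modulusX.
    rewrite -!mulrA ler_wpM2l // -[leRHS]mul1r.
    by rewrite ler_pM ?modulus_ge0 ?modulus_expr_le1.
  - exact/geom_bounded_cvg/geom_bounded_power.
  - rewrite expr1.
    have -> : modulus q ^+ N * c * rho / (1 - rho) =
      rho * (c / (1 - rho) * modulus q ^+ N) by ring.
    rewrite ler_piMl ?(ltW r1) //.
    by rewrite mulr_ge0 ?divr_ge0 ?subr_ge0 // ltW.
apply/cvg_modulus.
have b0 : (fun N => c / (1 - rho) * modulus q ^+ N) @ \oo --> (0 : R).
  by apply: cvg_geometric; rewrite ger0_norm ?modulus_ge0 // -modulus_lt1.
apply: (squeeze_cvgr _ (cvg_cst 0) b0).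
by near=> n; rewrite modulus_ge0 bnd.
Unshelve. all: by end_near. Qed.

End PowerSeriesAtPowers.

Section IteratedSums.
Variables (R : realType) (q : cplx R).
Local Notation C := (cplx R).
Hypothesis q_lt1 : `|q| < 1.
Variable A : nat -> C.
Hypothesis A_geom : geom_bounded A.

(* With T the shift, this is (q^l T; q)_oo^-1 A evaluated at m: it is the S_m of
   the header at l = 0, and tends to A_m as l grows. *)
Definition weighted_tail (l m : nat) : C :=
  limn (series (fun i => q ^+ (l * i) * (A (m + i)%N / qpoch q q i))).

Lemma weighted_tail_term_geom l m :
  geom_bounded (fun i => q ^+ (l * i) * (A (m + i)%N / qpoch q q i)).
Proof.
have [K hK] := qfactV_bounded q_lt1.
apply: geom_bounded_power => //.
have : geom_bounded (fun i => (qpoch q q i)^-1 * A (m + i)%N).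
  by apply: geom_boundedM hK _; apply: geom_bounded_shift.
by apply: geom_bounded_le => n; rewrite mulrC.
Qed.

Lemma weighted_tailS l m :
  weighted_tail l.+1 m = weighted_tail l m - q ^+ l * weighted_tail l m.+1.
Proof.
pose w l m := series (fun i => q ^+ (l * i) * (A (m + i)%N / qpoch q q i)).
have cw k p : w k p @ \oo --> weighted_tail k p.
  exact: geom_bounded_cvg (weighted_tail_term_geom k p).
have wE n : w l.+1 m n.+1 = w l m n.+1 - q ^+ l * w l m.+1 n.
  elim: n => [|n IH].
    by rewrite /w /series /= !big_nat1 big_geq // !muln0 mulr0 subr0.
  rewrite /w seriesSr -/(w _ _) IH [in RHS]seriesSr -/(w l m).
  rewrite [in RHS]seriesSr -/(w l m.+1).
  have nz := qfact_neq0 q_lt1 n.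
  have nz1 : 1 - q * q ^+ n != 0.
    by rewrite subr_eq0 eq_sym small_expr_neq1.
  rewrite addnS addSn qpochS mulSn mulnS !exprD exprS.
  by field; rewrite nz nz1.
have cS : (fun n => w l.+1 m n.+1) @ \oo --> weighted_tail l.+1 m.
  by have := cw l.+1 m; rewrite -cvg_shiftS.
have cR : (fun n => w l m n.+1 - q ^+ l * w l m.+1 n) @ \oo -->
    weighted_tail l m - q ^+ l * weighted_tail l m.+1.
  apply: cvgB; last exact: cvgM (cvg_cst _) (cw _ _).
  by have := cw l m; rewrite -cvg_shiftS.
rewrite -(cvg_lim (@norm_hausdorff _ C) cS) -(cvg_lim (@norm_hausdorff _ C) cR).
by congr (limn _); apply/funext.
Qed.

Lemma cvg_weighted_tail m : (weighted_tail ^~ m) @ \oo --> A m.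
Proof.
have := cvg_power_series_expr q_lt1 (weighted_tail_term_geom 0 m).
rewrite mul0n mul1r addn0 [qpoch q q 0]big_ord0 divr1.
suff -> : weighted_tail ^~ m = (fun N => limn (series (fun n =>
    q ^+ (N * n) * (q ^+ (0 * n) * (A (m + n)%N / qpoch q q n))))) by [].
apply/funext => l; congr (limn (series _)).
by apply/funext => i; rewrite mul0n mul1r.
Qed.

Lemma weighted_tail_inversion : exists P : R, 0 <= P /\
  forall (N : nat) (e th : R), 0 <= e -> 0 <= th <= 1 ->
  (forall m, (N <= m)%N -> modulus (weighted_tail 0 m) <= e * th ^+ m) ->
  forall m, (N <= m)%N -> modulus (A m) <= P * e * th ^+ m.
Proof.
have [|P hP] := @modulus_prod1D_bounded _ (fun i => (modulus q ^+ i)%:C%C).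
  have := geom_bounded_expr q_lt1; apply: geom_bounded_le => n.
  by rewrite modulus_real ger0_norm ?exprn_ge0 ?modulus_ge0 // modulusX.
pose p l := \prod_(i < l) (1 + modulus q ^+ i).
have q0 l : 0 <= modulus q ^+ l by rewrite exprn_ge0 // modulus_ge0.
have p0 l : 0 <= p l by apply: prodr_ge0 => i _; rewrite addr_ge0.
have pP l : p l <= P.
  have := hP l; rewrite modulus_prod; congr (_ <= _); apply: eq_bigr => i _.
  rewrite -(rmorph1 (@real_complex R)) -rmorphD modulus_real ger0_norm //.
  by rewrite addr_ge0.
have P0 : 0 <= P by apply: le_trans (pP 0%N).
exists P; split => // N e th e0 /andP[th0 th1] hN m Nm.
have key l : forall m, (N <= m)%N ->
    modulus (weighted_tail l m) <= p l * e * th ^+ m.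
  elim: l => [|l IH] k Nk; first by rewrite /p big_ord0 mul1r hN.
  rewrite weighted_tailS; apply: (le_trans (modulusD _ _)).
  rewrite modulusN modulusM modulusX /p big_ord_recr -/(p l) /=.
  have -> : p l * (1 + modulus q ^+ l) * e * th ^+ k =
    p l * e * th ^+ k + modulus q ^+ l * (p l * e * th ^+ k) by ring.
  apply: lerD; first exact: IH.
  apply: ler_wpM2l => //; apply: (le_trans (IH _ (leqW Nk))).
  rewrite ler_wpM2l ?mulr_ge0 //.
  by rewrite exprS ler_piMl // exprn_ge0.
have h := cvg_modulus_lim (@cvg_weighted_tail m).
apply: (cvgr_to_le h); near=> l; apply: (le_trans (key l m Nm)).
by rewrite ler_wpM2r ?exprn_ge0 // ler_wpM2r.
Unshelve. all: by end_near. Qed.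

End IteratedSums.

(** * Exchange of the two summations *)

Section SummationExchange.
Variables (R : realType) (q : cplx R).
Local Notation C := (cplx R).
Hypothesis q_lt1 : `|q| < 1.
Variable A : nat -> C.
Hypothesis A_geom : geom_bounded A.

Let tail m := limn (series (fun i => A (m + i)%N / qpoch q q i)).

Lemma weighted_tail0 m : weighted_tail q A 0 m = tail m.
Proof.
rewrite /weighted_tail /tail; congr (limn (series _)); apply/funext => i.
by rewrite mul0n mul1r.
Qed.

Lemma tail_term_cvg m : cvgn (series (fun i => A (m + i)%N / qpoch q q i)).
Proof.
have := geom_bounded_cvg (weighted_tail_term_geom q_lt1 A_geom 0 m).
by under [X in series X]eq_fun do rewrite mul0n mul1r.
Qed.

Variable d : nat -> C.
Let remainder N := \sum_(m < N)
  d m * (tail m - series (fun i => A (m + i)%N / qpoch q q i) (N - m)%N).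

Lemma partial_sum_remainder N :
  series (fun n => A n * \sum_(m < n.+1) d m / qpoch q q (n - m)) N =
  series (fun m => d m * tail m) N - remainder N.
Proof.
rewrite /remainder /series /= !big_mkord -sumrB.
under [RHS]eq_bigr do rewrite -mulrBr opprB addrC subrK mulr_sumr big_mkord.
rewrite -(sum_triangle (fun m i => d m * (A (m + i)%N / qpoch q q i))).
apply: eq_bigr => n _; rewrite mulr_sumr; apply: eq_bigr => m _.
by rewrite subnKC 1?mulrCA // -ltnS.
Qed.

Lemma remainder_le (a th K : R) N m :
  (forall n, modulus (qpoch q q n)^-1 <= K) -> (m <= N)%N ->
  0 <= a -> 0 <= th < 1 ->
  (forall n, (N <= n)%N -> modulus (A n) <= a * th ^+ n) ->
  modulus (tail m - series (fun i => A (m + i)%N / qpoch q q i) (N - m)%N)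
    <= K * a * th ^+ N / (1 - th).
Proof.
move=> hK mN a0 /andP[th0 th1] hA.
have K0 : 0 <= K by apply: le_trans (hK 0%N); exact: modulus_ge0.
have -> : K * a * th ^+ N = (K * a * th ^+ m) * th ^+ (N - m).
  by rewrite -[in LHS](subnKC mN) exprD mulrA.
apply: modulus_tail_le.
- by rewrite !mulr_ge0 // exprn_ge0.
- by rewrite th0.
- move=> i Ni; rewrite modulusM -mulrA -exprD -mulrA [leRHS]mulrC.
  by rewrite ler_pM ?modulus_ge0 // hA // -leq_subLR.
- exact: tail_term_cvg.
Qed.

Lemma remainder_cvg0_bounded (D : R) : (forall m, modulus (d m) <= D) ->
  remainder @ \oo --> (0 : C).
Proof.
move=> hD; have [K hK] := qfactV_bounded q_lt1.
have [c [rho [c0 r0 r1 Ab]]] := A_geom.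
have D0 : 0 <= D by apply: le_trans (hD 0%N); exact: modulus_ge0.
have K0 : 0 <= K by apply: le_trans (hK 0%N); exact: modulus_ge0.
pose e := D * (K * c / (1 - rho)).
have e0 : 0 <= e by rewrite !mulr_ge0 // invr_ge0 subr_ge0 ltW.
pose b (N : nat) := (N%:R : C) * (e * rho ^+ N)%:C%C.
have /geom_bounded_cvg0/cvg0_modulus b0 : geom_bounded b.
  apply: geom_bounded_natr; exists e, rho; split => // n.
  by rewrite modulus_real ger0_norm // mulr_ge0 // exprn_ge0 // ltW.
apply: cvg0_modulus_le b0 => N.
have -> : b N = ((e * rho ^+ N) *+ N)%:C%C.
  rewrite /b -(rmorph_nat (@real_complex R)) -rmorphM; congr (_%:C)%C.
  by rewrite mulr_natl.
rewrite modulus_real ger0_norm; last first.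
  by rewrite mulrn_wge0 // mulr_ge0 // exprn_ge0 // ltW.
apply: le_trans (modulus_sum _ _ _) _.
rewrite -[X in _ *+ X]card_ord -sumr_const; apply: ler_sum => m _.
have -> : e * rho ^+ N = D * (K * c * rho ^+ N / (1 - rho)) by rewrite /e; ring.
rewrite modulusM ler_pM ?modulus_ge0 //; apply: remainder_le => //.
  exact: ltnW.
by rewrite (ltW r0).
Qed.

Lemma remainder_cvg0_geometric (X del K : R) : 1 < X -> 0 < del ->
  (forall m, del * X ^+ m <= modulus (d m) <= K * X ^+ m) ->
  (fun m => d m * tail m) @ \oo --> (0 : C) ->
  remainder @ \oo --> (0 : C).
Proof.
move=> X1 del0 hd dt0; have [L hL] := qfactV_bounded q_lt1.
have [P [P0 hP]] := weighted_tail_inversion q_lt1 A_geom.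
have X0 : 0 < X by lra.
pose th := X^-1; have th0 : 0 < th by rewrite invr_gt0.
have th1 : th < 1 by rewrite invf_lt1.
have L0 : 0 <= L by apply: le_trans (hL 0%N); exact: modulus_ge0.
have K0 : 0 <= K.
  by have /andP[h1 h2] := hd 0%N; rewrite !mulr1 in h1 h2; lra.
apply/cvg_modulus_lt => e e0.
pose Q := K * L * P / (1 - th) / (1 - th) / del.
have Q0 : 0 <= Q by rewrite !mulr_ge0 ?invr_ge0 ?subr_ge0 // ltW.
pose e1 := e / (Q + 1).
have e10 : 0 < e1 by rewrite divr_gt0 // ltr_wpDl.
have [N0 _ hN0] : \forall m \near \oo, modulus (d m * tail m) < e1.
  move/cvg_modulus_lt: dt0 => /(_ e1 e10); apply: filterS => m.
  by rewrite subr0.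
have tailb m : (N0 <= m)%N -> modulus (weighted_tail q A 0 m) <= e1 / del * th ^+ m.
  move=> /hN0 /=; rewrite weighted_tail0 modulusM => h.
  have /andP[h1 _] := hd m; have Xm : 0 < X ^+ m by rewrite exprn_gt0.
  rewrite /th exprVn -mulrA -invfM ler_pdivlMr ?mulr_gt0 //.
  by apply/ltW/(le_lt_trans _ h); rewrite mulrC ler_wpM2r ?modulus_ge0.
have Ab := hP N0 (e1 / del) th (ltW (divr_gt0 e10 del0)).
rewrite (ltW th0) (ltW th1) in Ab; have {}Ab := Ab isT tailb.
exists N0 => // N /= N0N; rewrite subr0.
apply: le_lt_trans (modulus_sum _ _ _) _.
apply: (@le_lt_trans _ _ (\sum_(m < N) (Q * (1 - th) * e1) * th ^+ (N - m))).
  apply: ler_sum => m _; rewrite modulusM.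
  have -> : Q * (1 - th) * e1 * th ^+ (N - m) =
    (K * X ^+ m) * (L * (P * (e1 / del)) * th ^+ N / (1 - th)).
    have -> : th ^+ N = th ^+ m * th ^+ (N - m).
      by rewrite -exprD subnKC // ltnW.
    rewrite /Q [th ^+ m]exprVn -/th; move: (th ^+ _) => y; rewrite /th.
    have Xm : X ^+ m != 0 by rewrite expf_neq0 // gt_eqF.
    by field; rewrite Xm (gt_eqF X0) (gt_eqF del0) subr_eq0 (gt_eqF X1).
  rewrite ler_pM ?modulus_ge0 //; first by have /andP[] := hd m.
  apply: remainder_le => //.
  - exact: ltnW.
  - by rewrite mulr_ge0 // ltW // divr_gt0.
  - by rewrite ltW.
  - by move=> n Nn; apply: Ab; apply: leq_trans Nn.
rewrite -mulr_sumr (reindex_inj rev_ord_inj) /=.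
apply: (@le_lt_trans _ _ (Q * e1)); last first.
  rewrite /e1 mulrA ltr_pdivrMr ?ltr_wpDl // mulrC ltr_pM2l //.
  by rewrite ltrDl.
have -> : Q * e1 = Q * (1 - th) * e1 * (1 - th)^-1.
  by field; rewrite subr_eq0 (gt_eqF th1).
apply: ler_wpM2l; first by rewrite mulr_ge0 ?(ltW e10) ?(mulr_ge0 Q0) // subr_ge0 ltW.
apply: le_trans (sum_expr_le N _); last by rewrite (ltW th0).
apply: ler_sum => i _; rewrite subKn // exprS.
by rewrite ler_piMl ?(ltW th1) // exprn_ge0 // ltW.
Qed.

Lemma iterated_series_exchange :
  cvgn (series (fun m => d m * tail m)) ->
  (exists D : R, forall m, modulus (d m) <= D) \/
  (exists X del K : R, [/\ 1 < X, 0 < del &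
     forall m, del * X ^+ m <= modulus (d m) <= K * X ^+ m]) ->
  series (fun n => A n * \sum_(m < n.+1) d m / qpoch q q (n - m)) @ \oo -->
  limn (series (fun m => d m * tail m)).
Proof.
move=> cd hd.
have r0 : remainder @ \oo --> (0 : C).
  case: hd => [[D hD]|[X [del [K [X1 del0 hd]]]]].
    exact: remainder_cvg0_bounded hD.
  exact: remainder_cvg0_geometric X1 del0 hd (cvg_series_cvg_0 cd).
rewrite -[X in _ --> X]subr0.
have -> : series (fun n => A n * \sum_(m < n.+1) d m / qpoch q q (n - m)) =
  (fun N => series (fun m => d m * tail m) N - remainder N).
  by apply/funext => N; rewrite partial_sum_remainder.
exact: cvgB cd r0.
Qed.

End SummationExchange.

(** * q-binomial theorems *)

Section QIdentities.
Variables (R : realType) (q : cplx R).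
Local Notation C := (cplx R).
Hypothesis q_lt1 : `|q| < 1.
Hypothesis q_neq0 : q != 0.

Lemma gauss_binomial m (w : C) :
  \sum_(j < m.+1) (\prod_(i < j) ((q ^+ m - q ^+ i) / (1 - q ^+ i.+1))) * w ^+ j
  = qpoch w q m.
Proof.
pose E m j : C := \prod_(i < j) ((q ^+ m - q ^+ i) / (1 - q ^+ i.+1)).
have nz i : 1 - q ^+ i.+1 != 0.
  by rewrite subr_eq0 eq_sym exprS small_expr_neq1.
have E0 k : E k 0%N = 1 by rewrite /E big_ord0.
have ES k j : E k j.+1 = E k j * ((q ^+ k - q ^+ j) / (1 - q ^+ j.+1)).
  by rewrite /E big_ord_recr.
have ESS k j : E k.+1 j.+1 = (q ^+ k.+1 - 1) * q ^+ j / (1 - q ^+ j.+1) * E k j.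
  elim: j => [|j IH]; first by rewrite ES !E0 expr0 expr1 mulr1 mul1r mulr1.
  rewrite ES IH [E k j.+1]ES; have := nz j; have := nz j.+1.
  rewrite !exprS => h1 h2; field.
  by rewrite h1 h2.
have pascal k j : E k.+1 j.+1 = E k j.+1 - q ^+ k * E k j.
  by rewrite ESS ES; have := nz j; rewrite !exprS => h; field.
have Evan k : E k k.+1 = 0 by rewrite ES subrr mul0r mulr0.
change (\sum_(j < m.+1) E m j * w ^+ j = qpoch w q m).
elim: m => [|k IH].
  by rewrite big_ord1 E0 mul1r /qpoch big_ord0.
rewrite big_ord_recl /= E0 expr0 mulr1.
under eq_bigr do rewrite /bump /= add1n pascal exprS mulrBl.
rewrite sumrB.
have -> : \sum_(i < k.+1) q ^+ k * E k i * (w * w ^+ i) =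
    q ^+ k * w * qpoch w q k.
  by rewrite -IH mulr_sumr; apply: eq_bigr => i _; ring.
have -> : \sum_(i < k.+1) E k i.+1 * (w * w ^+ i) = qpoch w q k - 1.
  have : \sum_(j < k.+2) E k j * w ^+ j = qpoch w q k.
    by rewrite big_ord_recr /= IH Evan mul0r addr0.
  rewrite big_ord_recl /= E0 mulr1 => <-; rewrite addrAC subrr add0r.
  by apply: eq_bigr => i _; rewrite /bump /= add1n exprS.
by rewrite qpochS; ring.
Qed.

Lemma terminating_q_binomial m (y : C) :
  \sum_(j < m.+1) qpoch (q ^- m) q j / qpoch q q j * y ^+ j = qpoch (y * q ^- m) q m.
Proof.
rewrite -gauss_binomial; apply: eq_bigr => j _.
rewrite exprMn mulrCA mulrC; congr (_ * _).
have qm : q ^+ m != 0 by rewrite expf_neq0.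
rewrite /qpoch -prodf_div -[q ^- m ^+ j]/((q ^- m) ^+ j).
rewrite -[X in _ * _ ^+ X]card_ord -prodr_const -big_split.
apply: eq_bigr => i _ /=; rewrite -exprS mulrAC; congr (_ / _).
by rewrite mulrBl mulrC divff // [q ^+ i * _]mulrC.
Qed.

Lemma qpoch_expr_shift m n :
  qpoch (q ^+ n.+1 * q ^- m) q m =
  if (m <= n)%N then qpoch q q n / qpoch q q (n - m) else 0.
Proof.
case: leqP => [mn|nm].
  rewrite -[in qpoch q q n](subnK mn) qpochD [RHS]mulrAC divff ?qfact_neq0 // mul1r.
  rewrite -exprS -subSn // -[in q ^+ n.+1](subnK (leqW mn)) exprD mulfK //.
  by rewrite expf_neq0.
have im : (m - n.+1 < m)%N by rewrite ltn_subrL /= (leq_trans _ nm).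
rewrite /qpoch (bigD1 (Ordinal im)) //= mulrAC -exprD subnKC //.
by rewrite divff ?subrr ?mul0r // expf_neq0.
Qed.

Section CauchyGenerating.
Variables U V : C.
Hypothesis U_lt1 : `|U| < 1.
Let f n := cauchy_poly q n U V / qpoch q q n.

Lemma cauchy_coefS n : f n.+1 = f n * ((U - q ^+ n * V) / (1 - q ^+ n.+1)).
Proof.
rewrite /f /cauchy_poly big_ord_recr qpochS -exprS /=.
by rewrite invfM mulrACA.
Qed.

Lemma geom_bounded_cauchy : geom_bounded f.
Proof.
have q0 := geom_bounded_cvg0 (geom_bounded_expr q_lt1).
have h : (fun n => U - q ^+ n * V) @ \oo --> U - 0 * V.
  exact: cvgB (cvg_cst _) (cvgM q0 (cvg_cst _)).
have h1 := cvg_1Bexpr q_lt1 q.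
have h2 := cvgM h (cvgV (oner_neq0 _) h1).
rewrite mul0r subr0 invr1 mulr1 in h2.
apply: (@geom_bounded_ratio _ _ _ U cauchy_coefS); last by rewrite -modulus_lt1.
have -> : (fun n => (U - q ^+ n * V) / (1 - q ^+ n.+1)) =
  (fun n => (U - q ^+ n * V) / (1 - q * q ^+ n)).
  by apply/funext => n; rewrite exprS.
exact: h2.
Qed.

Definition cauchy_gen N := limn (series (fun n => q ^+ (N * n) * f n)).

Lemma cauchy_gen_cvg N : cvgn (series (fun n => q ^+ (N * n) * f n)).
Proof. by apply/geom_bounded_cvg/geom_bounded_power => //; exact: geom_bounded_cauchy. Qed.

Lemma cauchy_genS N :
  (1 - U * q ^+ N) * cauchy_gen N = (1 - V * q ^+ N) * cauchy_gen N.+1.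
Proof.
pose w N := series (fun n => q ^+ (N * n) * f n).
have cw k : w k @ \oo --> cauchy_gen k by exact: cauchy_gen_cvg.
have wE n : w N n.+1 - U * q ^+ N * w N n = w N.+1 n.+1 - V * q ^+ N * w N.+1 n.
  elim: n => [|n IH].
    by rewrite /w /series /= !big_nat1 !big_geq // !muln0 !mulr0.
  have wS k p : w k p.+1 = w k p + q ^+ (k * p) * f p by rewrite /w seriesSr.
  have h : 1 - q ^+ n.+1 != 0.
    by rewrite subr_eq0 eq_sym exprS small_expr_neq1.
  have fE : f n.+1 * (1 - q ^+ n.+1) = f n * (U - q ^+ n * V).
    by rewrite cauchy_coefS -mulrA divfK.
  rewrite [w N n.+2]wS [w N.+1 n.+2]wS {2}[w N n.+1]wS {2}[w N.+1 n.+1]wS.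
  move: fE IH; rewrite !mulSn !mulnS !exprD exprS.
  move: (w N n.+1) (w N.+1 n.+1) (w N n) (w N.+1 n) => x' y' x y.
  move: (f n.+1) (f n) (q ^+ N) (q ^+ (N * n)) (q ^+ n) => fS fn Q Qn qn fE IH.
  transitivity ((x' - U * Q * x) + Q * Qn * (fS * (1 - q * qn))
    + q * qn * Q * Qn * fS - U * Q * Qn * fn); first by ring.
  by rewrite IH fE; ring.
have cL : (fun n => w N n.+1 - U * q ^+ N * w N n) @ \oo -->
    cauchy_gen N - U * q ^+ N * cauchy_gen N.
  apply: cvgB; last exact: cvgM (cvg_cst _) (cw _).
  by have := cw N; rewrite -cvg_shiftS.
have cR : (fun n => w N.+1 n.+1 - V * q ^+ N * w N.+1 n) @ \oo -->
    cauchy_gen N.+1 - V * q ^+ N * cauchy_gen N.+1.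
  apply: cvgB; last exact: cvgM (cvg_cst _) (cw _).
  by have := cw N.+1; rewrite -cvg_shiftS.
rewrite !mulrBl !mul1r.
rewrite -(cvg_lim (@norm_hausdorff _ C) cL) -(cvg_lim (@norm_hausdorff _ C) cR).
by congr (limn _); apply/funext.
Qed.

Lemma cauchy_gen_qpoch N :
  qpoch U q N * cauchy_gen 0 = qpoch V q N * cauchy_gen N.
Proof.
elim: N => [|N IH]; first by rewrite /qpoch !big_ord0.
by rewrite !qpochS -[RHS]mulrA -cauchy_genS mulrAC IH -mulrA [_ * (1 - _)]mulrC.
Qed.

Lemma cauchy_gen0E : cauchy_gen 0 = qpoch_inf V q / qpoch_inf U q.
Proof.
have U1 k : U * q ^+ k != 1 by exact: small_expr_neq1.
have c1 := cvg_power_series_expr q_lt1 geom_bounded_cauchy.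
have f0 : f 0%N = 1 by rewrite /f /cauchy_poly /qpoch !big_ord0 divr1.
rewrite f0 in c1.
have cL : (fun N => qpoch U q N * cauchy_gen 0) @ \oo -->
    qpoch_inf U q * cauchy_gen 0.
  exact: cvgM (@qpoch_cvg _ q q_lt1 U) (cvg_cst _).
have cR : (fun N => qpoch V q N * cauchy_gen N) @ \oo --> qpoch_inf V q * 1.
  exact: cvgM (@qpoch_cvg _ q q_lt1 V) c1.
apply: (canRL (mulfK (qpoch_inf_neq0 q_lt1 U1))); rewrite mulrC -[RHS]mulr1.
rewrite -(cvg_lim (@norm_hausdorff _ C) cL) -(cvg_lim (@norm_hausdorff _ C) cR).
by congr (limn _); apply/funext => N; rewrite /= cauchy_gen_qpoch.
Qed.

End CauchyGenerating.
End QIdentities.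

(** * Powers of q and bounds on the terms *)

Section ComplexPowers.
Variables (R : realType) (q lq : cplx R).
Local Notation C := (cplx R).
Hypothesis q_lt1 : `|q| < 1.
Hypothesis q_neq0 : q != 0.
Hypothesis lqE : cexp lq = q.

Lemma cexpD (v w : C) : cexp (v + w) = cexp v * cexp w.
Proof.
case: v w => [a b] [c d]; rewrite /cexp /=; simpc.
rewrite expRD cosD sinD; congr (_ +i* _)%C; ring.
Qed.

Lemma cexp0 : cexp (0 : C) = 1.
Proof. by rewrite /cexp /= expR0 cos0 sin0 mulr1 mulr0. Qed.

Lemma qpowD (v w : C) : qpow lq (v + w) = qpow lq v * qpow lq w.
Proof. by rewrite /qpow mulrDl cexpD. Qed.

Lemma qpow0 : qpow lq 0 = 1.
Proof. by rewrite /qpow mul0r cexp0. Qed.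

Lemma qpow_neq0 (w : C) : qpow lq w != 0.
Proof.
apply/eqP => h; have := qpowD w (- w).
by rewrite subrr qpow0 h mul0r => /eqP; rewrite oner_eq0.
Qed.

Lemma qpowN (w : C) : qpow lq (- w) = (qpow lq w)^-1.
Proof.
by apply: (mulfI (qpow_neq0 w)); rewrite -qpowD subrr qpow0 divff ?qpow_neq0.
Qed.

Lemma qpow_natr n : qpow lq n%:R = q ^+ n.
Proof.
elim: n => [|n IH]; first exact: qpow0.
by rewrite -addn1 natrD qpowD IH exprD /qpow mul1r lqE.
Qed.

Lemma qpow_intr (n : int) : qpow lq n%:~R = q ^ n.
Proof.
case: n => n; first by rewrite -exprnP -qpow_natr.
by rewrite NegzE mulrNz qpowN -exprnN -qpow_natr.
Qed.

Lemma qbinE n k : (k <= n)%N ->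
  qbin q lq n%:R k = qpoch q q n / (qpoch q q k * qpoch q q (n - k)).
Proof.
have nz := qfact_neq0 q_lt1.
move=> kn; rewrite /qbin qpowN qpow_natr.
have -> : qpow lq (n%:R * k%:R - 'C(k, 2)%:R) = q ^+ (n * k) / q ^+ 'C(k, 2).
  by rewrite qpowD qpowN -natrM !qpow_natr.
suff h : qpoch (q ^- n) q k * (-1) ^+ k * (q ^+ (n * k) / q ^+ 'C(k, 2)) =
    qpoch q q n / qpoch q q (n - k).
  have -> : qpoch q q n / (qpoch q q k * qpoch q q (n - k)) =
      qpoch q q n / qpoch q q (n - k) / qpoch q q k.
    by rewrite invfM [_^-1 * _]mulrC mulrA.
  by rewrite -h; ring.
elim: k kn => [|k IH] kn.
  rewrite muln0 subn0 (divff (nz n)) bin0n !expr0 divr1 !mulr1.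
  by rewrite /qpoch big_ord0.
have {}IH := IH (ltnW kn).
set p := (n - k.+1)%N; have pE : (n - k = p.+1)%N by rewrite /p subnSK.
have qn : q ^+ n = q ^+ k * (q * q ^+ p).
  by rewrite -exprS -exprD -pE subnKC // ltnW.
rewrite pE [qpoch q q p.+1]qpochS in IH.
have nz1 : 1 - q * q ^+ p != 0 by rewrite subr_eq0 eq_sym small_expr_neq1.
have -> : qpoch q q n / qpoch q q p =
    qpoch q q n / (qpoch q q p * (1 - q * q ^+ p)) * (1 - q * q ^+ p).
  by field; rewrite nz1 nz.
rewrite -IH binS bin1 mulnS qpochS !exprD exprSr.
have -> : q * q ^+ p = q ^+ n / q ^+ k by rewrite qn [RHS]mulrAC divff ?mul1r // expf_neq0.
have n0 : q ^+ n != 0 by rewrite expf_neq0.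
have k0 : q ^+ k != 0 by rewrite expf_neq0.
have c0 : q ^+ 'C(k, 2) != 0 by rewrite expf_neq0.
move: (q ^+ n) (q ^+ k) (q ^+ 'C(k, 2)) n0 k0 c0 => Qn Qk Qc n0 k0 c0.
by field; rewrite n0 k0 c0.
Qed.

End ComplexPowers.

Section HypergeometricTerm.
Variables (R : realType) (q : cplx R).
Local Notation C := (cplx R).
Hypothesis q_lt1 : `|q| < 1.

Lemma cvg_expr0 (a : C) : `|a| < 1 -> (fun n => a ^+ n) @ \oo --> (0 : C).
Proof. by move=> a1; apply: geom_bounded_cvg0; apply: geom_bounded_expr. Qed.

Lemma scaled_expr_dichotomy (w Q : C) : Q != 0 -> [\/ Q = 1, `|Q| < 1 | `|Q^-1| < 1] ->
  (exists2 l : C, (fun n => w * Q ^+ n) @ \oo --> l & modulus l < 1) \/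
  (exists N, forall n, (N <= n)%N -> 1 <= modulus (w * Q ^+ n)).
Proof.
move=> Q0 hQ; have [->|w0] := eqVneq w 0.
  left; exists 0; last by rewrite modulus0.
  by under eq_fun do rewrite mul0r; apply: cvg_cst.
case: hQ => [->|Q1|Q1].
- have [w1|w1] := ltP (modulus w) 1.
    left; exists w => //; under eq_fun do rewrite expr1n mulr1.
    exact: cvg_cst.
  by right; exists 0%N => n _; rewrite expr1n mulr1.
- left; exists (w * 0); last by rewrite mulr0 modulus0.
  exact: cvgM (cvg_cst w) (cvg_expr0 Q1).
right; move/cvg_modulus_lt: (cvg_expr0 Q1) => /(_ (modulus w)).
rewrite modulus_gt0 w0 => /(_ isT) [N _ hN]; exists N => n /hN /=.
rewrite subr0 exprVn modulusV modulusM.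
have Qn : 0 < modulus (Q ^+ n) by rewrite modulus_gt0 expf_neq0.
by rewrite -div1r ltr_pdivrMr // => /ltW.
Qed.

Lemma qpoch_base2 n : qpoch (q ^+ 2) (q ^+ 2) n = qpoch q q n * qpoch (- q) q n.
Proof.
rewrite /qpoch -big_split; apply: eq_bigr => i _ /=.
by rewrite -exprM mulnC exprM; ring.
Qed.

Lemma sqr_lt1 : `|q ^+ 2| < 1.
Proof. by rewrite normrX exprn_ilt1. Qed.

(* When |w Q^n| >= 1 eventually, g can only tend to 0 by terminating, because the
   q-shifted factorials that do not vanish stay away from 0. *)
Lemma hypergeometric_geom_bounded (X a w Q : C) : Q != 0 ->
  [\/ Q = 1, `|Q| < 1 | `|Q^-1| < 1] ->
  let g := fun k => qpoch X q k * qpoch a q k / qpoch (q ^+ 2) (q ^+ 2) k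
                   * \prod_(i < k) (w * Q ^+ i) in
  g @ \oo --> (0 : C) -> geom_bounded g.
Proof.
move=> Q0 hQ g g0.
have [[l wl l1]|[N hN]] := scaled_expr_dichotomy w Q0 hQ.
  have c2 := cvg_1Bexpr sqr_lt1 (q ^+ 2).
  pose tau n := (1 - X * q ^+ n) * (1 - a * q ^+ n)
    / (1 - q ^+ 2 * (q ^+ 2) ^+ n) * (w * Q ^+ n).
  have ct : tau @ \oo --> 1 * 1 / 1 * l.
    apply: cvgM wl; apply: cvgM (cvgV (oner_neq0 _) c2).
    exact: cvgM (cvg_1Bexpr q_lt1 X) (cvg_1Bexpr q_lt1 a).
  rewrite invr1 !mul1r in ct.
  apply: geom_bounded_ratio ct l1 => n.
  by rewrite /g /tau !qpochS big_ord_recr /= invfM; ring.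
have vanish b : (exists k, b * q ^+ k == 1) ->
    exists k, forall n, (k <= n)%N -> qpoch b q n = 0.
  move=> [k /eqP bk]; exists k.+1 => n kn.
  by rewrite /qpoch (bigD1 (Ordinal kn)) //= bk subrr mul0r.
have zero_case : (exists k, forall n, (k <= n)%N -> g n = 0) -> geom_bounded g.
  move=> [k hk]; apply: (@geom_bounded_eventually _ _ k 0 (1 / 2)).
  - by rewrite divr_gt0.
  - by rewrite ltr_pdivrMr // mul1r ltr1n.
  - by move=> n /hk ->; rewrite modulus0 mul0r.
have [/vanish[k hk]|X1] := pselect (exists k, X * q ^+ k == 1).
  by apply: zero_case; exists k => n /hk h; rewrite /g h !mul0r.
have [/vanish[k hk]|a1] := pselect (exists k, a * q ^+ k == 1).
  by apply: zero_case; exists k => n /hk h; rewrite /g h mulr0 !mul0r.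
have {}X1 k : X * q ^+ k != 1 by apply/negP => h; apply: X1; exists k.
have {}a1 k : a * q ^+ k != 1 by apply/negP => h; apply: a1; exists k.
have [/zero_case//|nz] := pselect (exists k, forall n, (k <= n)%N -> g n = 0).
pose M k := \prod_(i < k) (w * Q ^+ i).
have MN : M N != 0.
  apply/eqP => MN; apply: nz; exists N => n Nn.
  rewrite /g -/(M n); suff -> : M n = 0 by rewrite mulr0.
  by rewrite -(subnKC Nn) /M big_split_ord /= -/(M N) MN mul0r.
have Mle n : (N <= n)%N -> modulus (M N) <= modulus (M n).
  move=> /subnK <-; elim: (n - N)%N => // k IH; apply: le_trans IH _.
  rewrite addSn /M big_ord_recr /= modulusM ler_peMr ?modulus_ge0 //.
  by rewrite hN // leq_addl.
have [K1 hK1] := qpochV_bounded q_lt1 X1.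
have [K2 hK2] := qpochV_bounded q_lt1 a1.
have [K3 hK3] := qpoch_bounded sqr_lt1 (q ^+ 2).
have M0 : (fun k => modulus (M k)) @ \oo --> (0 : R).
  have b0 : (fun k => K1 * K2 * K3 * modulus (g k)) @ \oo --> (K1 * K2 * K3 * 0).
    by apply: cvgM; [exact: cvg_cst|exact/cvg0_modulus].
  rewrite mulr0 in b0; apply: (squeeze_cvgr _ (cvg_cst 0) b0).
  near=> k; rewrite modulus_ge0 /=.
  have -> : M k = (qpoch X q k)^-1 * (qpoch a q k)^-1 * qpoch (q ^+ 2) (q ^+ 2) k * g k.
    rewrite /g -/(M k).
    have h1 := qpoch_neq0 k X1; have h2 := qpoch_neq0 k a1.
    have h3 := qfact_neq0 sqr_lt1 k; field.
    by rewrite h1 h2 h3.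
  by rewrite !modulusM !ler_pM ?mulr_ge0 ?modulus_ge0.
have : modulus (M N) <= 0.
  by apply: (cvgr_to_ge M0); near=> n; apply: Mle; near: n; exists N.
by rewrite leNgt modulus_gt0 MN.
Unshelve. all: by end_near. Qed.

Lemma qratio_dichotomy (sigma x : C) :
  let d := fun m => qpoch sigma q m * x ^+ m / qpoch q q m in
  (exists D : R, forall m, modulus (d m) <= D) \/
  (exists X del K : R, [/\ 1 < X, 0 < del &
     forall m, del * X ^+ m <= modulus (d m) <= K * X ^+ m]).
Proof.
move=> d.
have [K1 hK1] := qpoch_bounded q_lt1 sigma.
have [K2 hK2] := qfactV_bounded q_lt1.
have [K3 hK3] := qpoch_bounded q_lt1 q.
have K10 : 0 <= K1 by apply: le_trans (hK1 0%N); exact: modulus_ge0.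
have K20 : 0 <= K2 by apply: le_trans (hK2 0%N); exact: modulus_ge0.
have up m : modulus (d m) <= K1 * K2 * modulus x ^+ m.
  rewrite !modulusM modulusX mulrAC ler_wpM2r ?exprn_ge0 ?modulus_ge0 //.
  by rewrite ler_pM ?modulus_ge0.
have [x1|x1] := leP (modulus x) 1.
  left; exists (K1 * K2) => m; apply: le_trans (up m) _.
  by rewrite ler_piMr ?mulr_ge0 // exprn_ile1 // modulus_ge0.
have [[k /eqP bk]|s1] := pselect (exists k, sigma * q ^+ k == 1).
  left; exists (\sum_(i < k.+1) modulus (d i)) => m.
  have [mk|km] := ltnP m k.+1.
    rewrite (bigD1 (Ordinal mk)) //= lerDl sumr_ge0 // => i _.
    exact: modulus_ge0.
  rewrite /d /qpoch (bigD1 (Ordinal km)) //= bk subrr !mul0r modulus0.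
  by rewrite sumr_ge0 // => i _; exact: modulus_ge0.
have {}s1 k : sigma * q ^+ k != 1 by apply/negP => h; apply: s1; exists k.
have [K4 hK4] := qpochV_bounded q_lt1 s1.
have K40 : 0 < K4.
  by apply: lt_le_trans (hK4 0%N); rewrite modulus_gt0 invr_neq0 // qpoch_neq0.
have K30 : 0 < K3.
  by apply: lt_le_trans (hK3 0%N); rewrite modulus_gt0 qfact_neq0.
right; exists (modulus x), (K4 * K3)^-1, (K1 * K2); split => // [|m].
  by rewrite invr_gt0 mulr_gt0.
rewrite up andbT mulrC ler_pdivrMr ?mulr_gt0 // -modulusX.
have -> : x ^+ m = d m * ((qpoch sigma q m)^-1 * qpoch q q m).
  have h1 := qpoch_neq0 m s1; have h2 := qfact_neq0 q_lt1 m.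
  by rewrite /d; field; rewrite h1 h2.
by rewrite !modulusM ler_wpM2l ?mulr_ge0 ?modulus_ge0 // ler_pM ?modulus_ge0.
Qed.

End HypergeometricTerm.

(** * The double series *)

Section Assembly.
Variables (R : realType) (q : cplx R).
Local Notation C := (cplx R).
Hypothesis q_lt1 : `|q| < 1.
Hypothesis q_neq0 : q != 0.

Lemma cvg_series_linear p (c : nat -> C) (F : nat -> nat -> C) :
  (forall j, cvgn (series (F j))) ->
  series (fun n => \sum_(j < p) c j * F j n) @ \oo -->
  \sum_(j < p) c j * limn (series (F j)).
Proof.
move=> cF; elim: p => [|p IH].
  have -> : series (fun n => \sum_(j < 0) c j * F j n) = fun=> 0.
    by apply/funext => n; rewrite /series /= big1 // => i _; rewrite big_ord0.
  by rewrite big_ord0; exact: cvg_cst.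
rewrite big_ord_recr /=.
have -> : series (fun n => \sum_(j < p.+1) c j * F j n) =
    (fun N => series (fun n => \sum_(j < p) c j * F j n) N + c p * series (F p) N).
  apply/funext => N; rewrite /series /= mulr_sumr -big_split.
  by apply: eq_bigr => n _; rewrite big_ord_recr.
exact: cvgD IH (cvgM (cvg_cst _) (cF p)).
Qed.

Lemma q_binomial_tail_sum m (B : nat -> C) : geom_bounded B ->
  \sum_(j < m.+1) (qpoch (q ^- m) q j / qpoch q q j * q ^+ j)
     * limn (series (fun n => q ^+ (j * n) * B n)) =
  limn (series (fun i => qpoch q q (m + i) * B (m + i)%N / qpoch q q i)).
Proof.
move=> bB.
have := @cvg_series_linear m.+1
  (fun j => qpoch (q ^- m) q j / qpoch q q j * q ^+ j)
  (fun j n => q ^+ (j * n) * B n)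
  (fun j => geom_bounded_cvg (geom_bounded_power q_lt1 j bB)).
set u := (X in series X @ _ --> _) => hu.
have uE n : u n = if (m <= n)%N then qpoch q q n * B n / qpoch q q (n - m) else 0.
  rewrite /u; under eq_bigr => j _.
    rewrite mulrA -[X in X * _]mulrA -exprD -mulnS mulnC exprM.
    over.
  rewrite -mulr_suml terminating_q_binomial // qpoch_expr_shift //.
  by case: ifP => _; rewrite ?mul0r // mulrAC.
have uS N : series u (N + m)%N =
    series (fun i => qpoch q q (m + i) * B (m + i)%N / qpoch q q i) N.
  elim: N => [|N IH].
    rewrite add0n /series /= [RHS]big_geq // big_nat big1 // => i /andP[_ im].
    by rewrite uE leqNgt im.
  by rewrite addSn !seriesSr IH uE leq_addl addnK [(N + m)%N]addnC.
have {}hu : (fun N => series u (N + m)%N) @ \oo -->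
    \sum_(j < m.+1) (qpoch (q ^- m) q j / qpoch q q j * q ^+ j)
     * limn (series (fun n => q ^+ (j * n) * B n)).
  by move: hu; rewrite -(cvg_shiftn m (series u)).
rewrite -(cvg_lim (@norm_hausdorff _ C) hu).
by congr (limn _); apply/funext.
Qed.

Section Coefficients.
Variables (lq alpha u v z a sigma x t : C) (r s : int).
Hypothesis lqE : cexp lq = q.

Definition Lcoef (k : nat) : C :=
  qpoch (- qpow lq (- alpha)) q k * qpoch a q k * (t * z) ^+ k
  / qpoch (q ^+ 2) (q ^+ 2) k
  * qpow lq (k%:R * alpha + (r * 'C(k, 2)%:Z - s * 'C(k.+1, 2)%:Z)%:~R).

Let f n := cauchy_poly q n (u * t) (v * t) / qpoch q q n.
Let d m := qpoch sigma q m * x ^+ m / qpoch q q m.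

Lemma Lcoef_prod k : Lcoef k =
  qpoch (- qpow lq (- alpha)) q k * qpoch a q k / qpoch (q ^+ 2) (q ^+ 2) k *
  \prod_(i < k) ((t * z * qpow lq (alpha - s%:~R)) * (q ^ (r - s)) ^+ i).
Proof.
pose M := (t * z) ^+ k *
  qpow lq (k%:R * alpha + (r * 'C(k, 2)%:Z - s * 'C(k.+1, 2)%:Z)%:~R).
transitivity (qpoch (- qpow lq (- alpha)) q k * qpoch a q k
  / qpoch (q ^+ 2) (q ^+ 2) k * M); first by rewrite /Lcoef /M; ring.
congr (_ * _); rewrite {}/M.
elim: k => [|k IH].
  by rewrite big_ord0 mul0r add0r bin0n /= !mulr0 subrr qpow0 mul1r.
rewrite big_ord_recr /= -IH exprS.
have -> : k.+1%:R * alpha + (r * 'C(k.+1, 2)%:Z - s * 'C(k.+2, 2)%:Z)%:~R =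
   (k%:R * alpha + (r * 'C(k, 2)%:Z - s * 'C(k.+1, 2)%:Z)%:~R)
   + (alpha - s%:~R) + ((r - s) * k%:Z)%:~R :> C.
  have -> : r * 'C(k.+1, 2)%:Z - s * 'C(k.+2, 2)%:Z =
      (r * 'C(k, 2)%:Z - s * 'C(k.+1, 2)%:Z) - s + (r - s) * k%:Z.
    rewrite [in LHS]binS bin1 [in 'C(k.+1, 2)]binS bin1 !binS !bin1 bin0.
    lia.
  rewrite 2!intrD -addn1 natrD; ring.
rewrite !qpowD (qpow_intr lqE ((r - s) * k)).
by rewrite -exprz_exp -exprnP; ring.
Qed.

Lemma hahn_polyE n : hahn_poly q lq sigma n x =
  qpoch q q n * \sum_(m < n.+1) d m / qpoch q q (n - m).
Proof.
rewrite /hahn_poly mulr_sumr; apply: eq_bigr => m _.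
rewrite (qbinE q_lt1 q_neq0 lqE) -1?ltnS // /d.
by rewrite invfM; ring.
Qed.

Lemma cauchy_polyM n (c : C) :
  cauchy_poly q n (u * c) (v * c) = cauchy_poly q n u v * c ^+ n.
Proof.
rewrite /cauchy_poly -[X in _ ^+ X]card_ord -prodr_const -big_split.
by apply: eq_bigr => i _ /=; ring.
Qed.

Lemma LtildeE n : Ltilde q lq r s n alpha u v z a * (t ^+ n / qpoch q q n) =
  convolution Lcoef f n.
Proof.
rewrite /Ltilde /convolution mulr_suml; apply: eq_bigr => k _.
have kn : (k <= n)%N by rewrite -ltnS.
rewrite (qbinE q_lt1 q_neq0 lqE) // /f cauchy_polyM /Lcoef /qbin_neg.
have qE : qpow lq (alpha * k%:R - 'C(k, 2)%:R) *
    q ^ (r * 'C(k, 2)%:Z - s * 'C(k.+1, 2)%:Z + 'C(k, 2)%:Z) =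
    qpow lq (k%:R * alpha + (r * 'C(k, 2)%:Z - s * 'C(k.+1, 2)%:Z)%:~R).
  rewrite -(qpow_intr lqE) -qpowD; congr qpow.
  by rewrite [in X in _ + X]intrD; ring.
rewrite -qE qpoch_base2 // -[in t ^+ n](subnKC kn) exprD exprMn.
have h1 := qfact_neq0 q_lt1 n; have h2 := qfact_neq0 q_lt1 k.
have h3 := qfact_neq0 q_lt1 (n - k).
have h4 : qpoch (- q) q k != 0.
  have := qfact_neq0 (sqr_lt1 q_lt1) k.
  by rewrite qpoch_base2 // mulf_eq0 negb_or => /andP[].
by field; rewrite h1 h2 h3 h4.
Qed.

End Coefficients.

End Assembly.

Theorem theorem13 (R : realType) (q lq : cplx R)
    (alpha u v z a sigma x t : cplx R) (r s : int)
    (q_neq0 : q != 0) (q_lt1 : `|q| < 1) (lqE : cexp lq = q)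
    (ut_lt1 : `|u * t| < 1)
    (vt_neq : forall i : nat, v * t * q ^+ i != 1) :
  let lhs_term (n : nat) :=
    hahn_poly q lq sigma n x * Ltilde q lq r s n alpha u v z a
    * (t ^+ n / qpoch q q n) in
  let rhs_term (m k j : nat) :=
    qpoch sigma q m * x ^+ m / qpoch q q m
    * (qpoch (q ^- m) q j * qpoch (u * t) q j * q ^+ j
       / (qpoch (v * t) q j * qpoch q q j))
    * (qpoch (- qpow lq (- alpha)) q k * qpoch a q k * (t * z * q ^+ j) ^+ k
       / qpoch (q ^+ 2) (q ^+ 2) k)
    * qpow lq (k%:R * alpha
               + (r * 'C(k, 2)%:Z - s * 'C(k.+1, 2)%:Z)%:~R) in
  let rhs_k (m k : nat) := \sum_(j < m.+1) rhs_term m k j in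
  let rhs_m (m : nat) := infsum (rhs_k m) in
  (forall m : nat, infsum_cvg (rhs_k m)) ->
  infsum_cvg rhs_m ->
  infsum_cvg lhs_term /\
  infsum lhs_term =
    qpoch_inf (v * t) q / qpoch_inf (u * t) q * infsum rhs_m.
Proof.
move=> lhs_term rhs_term rhs_k rhs_m rhs_k_cvg rhs_m_cvg.
pose g := Lcoef q lq alpha z a t r s.
pose f n := cauchy_poly q n (u * t) (v * t) / qpoch q q n.
pose d m := qpoch sigma q m * x ^+ m / qpoch q q m.
pose c m j := d m * (qpoch (q ^- m) q j * qpoch (u * t) q j * q ^+ j
  / (qpoch (v * t) q j * qpoch q q j)).
have rhs_kE m k : rhs_k m k = \sum_(j < m.+1) c m j * (q ^+ (j * k) * g k).
  apply: eq_bigr => j _; rewrite /rhs_term /c /d /g /Lcoef.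
  by rewrite [(t * z * q ^+ j) ^+ k]exprMn exprM; ring.
have g_geom : geom_bounded g.
  have g0 : g @ \oo --> (0 : cplx R).
    have := cvg_series_cvg_0 (rhs_k_cvg 0%N).
    suff -> : rhs_k 0%N = g by [].
    apply/funext => k; rewrite rhs_kE big_ord1 /c /d /qpoch !big_ord0 mul0n.
    by rewrite !expr0 !mulr1 !divr1 !mul1r.
  have gE : g = fun k => qpoch (- qpow lq (- alpha)) q k * qpoch a q k
      / qpoch (q ^+ 2) (q ^+ 2) k *
      \prod_(i < k) ((t * z * qpow lq (alpha - s%:~R)) * (q ^ (r - s)) ^+ i).
    by apply/funext => k; rewrite /g Lcoef_prod.
  rewrite gE in g0 *; apply: hypergeometric_geom_bounded g0 => //.
    by rewrite expfz_neq0.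
  have q1 n : `|q ^+ n.+1| < 1 by rewrite normrX exprn_ilt1.
  case: (r - s) => [[|n]|n]; first by apply: Or31.
    exact/Or32/q1.
  by apply/Or33; rewrite NegzE -exprnN invrK; apply: q1.
have f_geom : geom_bounded f by apply: geom_bounded_cauchy.
pose B := convolution g f.
have B_geom : geom_bounded B by apply: geom_bounded_convolution.
pose F := cauchy_gen q (u * t) (v * t).
have V_neq0 j : qpoch (v * t) q j != 0 by apply: qpoch_neq0.
have FE j : qpoch (u * t) q j / qpoch (v * t) q j * F 0%N = F j.
  by rewrite mulrAC cauchy_gen_qpoch // mulrAC divff // mul1r.
have F0E : F 0%N = qpoch_inf (v * t) q / qpoch_inf (u * t) q.
  exact: cauchy_gen0E.
pose G j := limn (series (fun k => q ^+ (j * k) * g k)).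
have G_cvg j : cvgn (series (fun k => q ^+ (j * k) * g k)).
  by apply/geom_bounded_cvg/geom_bounded_power.
have FG j : G j * F j = limn (series (fun n => q ^+ (j * n) * B n)).
  have gj := geom_bounded_power q_lt1 j g_geom.
  have fj := geom_bounded_power q_lt1 j f_geom.
  rewrite -(cvg_lim (@norm_hausdorff _ (cplx R)) (cvg_series_convolution gj fj)).
  congr (limn (series _)); apply/funext => n.
  rewrite /B /convolution mulr_sumr; apply: eq_bigr => k _.
  rewrite mulrACA -exprD -mulnDr subnKC //.
  by rewrite -ltnS.
pose A n := qpoch q q n * B n.
have A_geom : geom_bounded A.
  by have [K hK] := qpoch_bounded q_lt1 q; apply: geom_boundedM hK B_geom.
pose tail m := limn (series (fun i => A (m + i)%N / qpoch q q i)).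
have rhs_mE m : F 0%N * rhs_m m = d m * tail m.
  have -> : rhs_m m = \sum_(j < m.+1) c m j * G j.
    rewrite /rhs_m /infsum; have -> : rhs_k m = fun k => \sum_(j < m.+1)
        c m j * (q ^+ (j * k) * g k) by apply/funext => k; rewrite rhs_kE.
    have h := @cvg_series_linear _ m.+1 (c m) (fun j k => q ^+ (j * k) * g k) G_cvg.
    by rewrite (cvg_lim (@norm_hausdorff _ (cplx R)) h).
  rewrite /tail -(q_binomial_tail_sum q_lt1 q_neq0 m B_geom) !mulr_sumr.
  apply: eq_bigr => j _; rewrite -FG -(FE j) /c.
  have h1 := V_neq0 j; have h2 := qfact_neq0 q_lt1 j.
  by field; rewrite h1 h2.
have dt_series : series (fun m => d m * tail m) = (fun N => F 0%N * series rhs_m N).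
  apply/funext => N; rewrite /series /= mulr_sumr.
  by apply: eq_bigr => m _; rewrite rhs_mE.
have dt_cvg : series (fun m => d m * tail m) @ \oo --> F 0%N * infsum rhs_m.
  by rewrite dt_series; exact: cvgM (cvg_cst _) rhs_m_cvg.
have := iterated_series_exchange q_lt1 A_geom (cvgP _ dt_cvg)
  (qratio_dichotomy q_lt1 sigma x).
rewrite (cvg_lim (@norm_hausdorff _ (cplx R)) dt_cvg) -F0E.
suff <- : lhs_term = fun n => A n * \sum_(m < n.+1) d m / qpoch q q (n - m).
  move=> h; split; first exact: cvgP h.
  by rewrite /infsum (cvg_lim (@norm_hausdorff _ (cplx R)) h).
apply/funext => n; rewrite /lhs_term -mulrA LtildeE // hahn_polyE //.
by rewrite /A /B mulrAC.
Qed.
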